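(* Let $\mathbb{T}=\mathbb{R}\cup\{-\infty\}$ be the real tropical semifield. For every separated $\mathbb{T}$-semimodule $M$ whose canonical metric $d$ on the associated projective space $\mathbb{P}(M)$ is finite (never takes the value $+\infty$), the projective space $\mathbb{P}(M)$ is contractible with reference to the topology induced by the canonical metric $d$.
   Context: **Semimodules.** On $\mathbb{T}=\mathbb{R}\cup\{-\infty\}$ put $a\oplus b=\max(a,b)$, $a\odot b=a+b$ (and $a\odot(-\infty)=-\infty$); $0_{\mathbb{T}}=-\infty$, $1_{\mathbb{T}}=0$, $\mathbb{T}^*=\mathbb{R}$. A $\mathbb{T}$-semimodule is a set $M$ with an associative commutative operation $\oplus$ having neutral element $0$, and a product $\odot:\mathbb{T}\times M\to M$ satisfying the usual associative and distributive properties, with $1_{\mathbb{T}}\odot v=v$ and $0_{\mathbb{T}}\odot v=0$. Linear maps are maps preserving $\oplus$ and $\odot$; submodules are subsets closed under the operations. $\mathbb{T}^n$ is the free semimodule with componentwise operations and canonical basis $e_1,\dots,e_n$. **Projective spaces.** $\mathbb{P}(M)=(M\setminus\{0\})/\sim$, where $x\sim y$ iff $x=\lambda\odot y$ for some $\lambda\in\mathbb{T}^*$. A linear map sending no nonzero element to $0$ induces a map (a projective map) of projective spaces. $\mathbb{TP}^1=\mathbb{P}(\mathbb{T}^2)$ is identified with $\mathbb{R}\cup\{\pm\infty\}$ by $[x^1:x^2]\mapsto x^1-x^2$, with the corresponding order; write $0_{\mathbb{T}}=[0_{\mathbb{T}}:1_{\mathbb{T}}]=-\infty$ and $\infty_{\mathbb{T}}=[1_{\mathbb{T}}:0_{\mathbb{T}}]=+\infty$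 for the endpoints. **Separated.** Let $B$ be the quotient semimodule of $\mathbb{T}^2$ by the relation: $(x^1,x^2)\sim(y^1,y^2)$ iff either ($x^1<x^2$, $y^1<y^2$ and $x^2=y^2$) or ($x^1\ge x^2$, $y^1\ge y^2$ and $x^1=y^1$). $M$ is separated if it contains no submodule isomorphic to $B$. **Canonical metric.** Let $M$ be separated. For $a\ne b$ in $\mathbb{P}(M)$ choose lifts $\bar a,\bar b\in M$ and let $f:\mathbb{TP}^1\to\mathbb{P}(M)$ be the projective map induced by the linear map $\bar f:\mathbb{T}^2\to M$ with $\bar f(e_1)=\bar b$, $\bar f(e_2)=\bar a$, so $f(0_{\mathbb{T}})=a$, $f(\infty_{\mathbb{T}})=b$. As $M$ is separated, the sets $f^{-1}(a)$ and $f^{-1}(b)$ are, respectively, a closed initial segment and a closed final segment of $\mathbb{TP}^1$, with extremal points $a_0$ and $b_0$, and $d(a,b)=|a_0-b_0|\in[0,+\infty]$, the Euclidean distance of the extremal points; this does not depend on the lifts. Also $d(a,a)=0$. *)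

(* Defs.v *)
From HB Require Import structures.
From mathcomp Require Import all_boot all_order all_algebra.
From mathcomp Require Import generic_quotient.
From mathcomp Require Import all_classical all_reals all_analysis.

Set Implicit Arguments.
Unset Strict Implicit.
Unset Printing Implicit Defensive.

Import Order.TTheory GRing.Theory Num.Theory.
Import numFieldNormedType.Exports.
Local Open Scope classical_set_scope.
Local Open Scope ring_scope.
Local Open Scope quotient_scope.

Record trop (R : realType) := Trop {
  trop_val : \bar R;
  trop_valP : (trop_val != +oo)%E
}.

HB.instance Definition _ (R : realType) := [isSub for @trop_val R].
HB.instance Definition _ (R : realType) := [Choice of trop R by <:].

Section Tropical.
Context {R : realType}.
Implicit Types a b c : trop R.

Fact trop_zero_subproof : (-oo%E : \bar R) != +oo%E.
Proof. by []. Qed.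

Fact trop_one_subproof : (0%E : \bar R) != +oo%E.
Proof. by []. Qed.

Fact trop_add_subproof a b :
  Order.max (trop_val a) (trop_val b) != +oo%E.
Proof. by case: a b => [x xP] [y yP] /=; rewrite /Order.max; case: ifP. Qed.

Fact trop_mul_subproof a b : (trop_val a + trop_val b)%E != +oo%E.
Proof. by case: a b => [[x| |] //= xP] [[y| |] //= yP]. Qed.

Definition trop_zero : trop R := Trop trop_zero_subproof.
Definition trop_one : trop R := Trop trop_one_subproof.
Definition trop_add a b : trop R := Trop (trop_add_subproof a b).
Definition trop_mul a b : trop R := Trop (trop_mul_subproof a b).

Fact trop_addA : associative trop_add.
Proof. by move=> a b c; apply: val_inj; rewrite /= maxA. Qed.

Fact trop_addC : commutative trop_add.
Proof. by move=> a b; apply: val_inj; rewrite /= maxC. Qed.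

Fact trop_add0 : left_id trop_zero trop_add.
Proof. by move=> a; apply: val_inj => /=; apply: max_r; rewrite leNye. Qed.

Fact trop_mulA : associative trop_mul.
Proof. by move=> a b c; apply: val_inj; rewrite /= addeA. Qed.

Fact trop_mulC : commutative trop_mul.
Proof. by move=> a b; apply: val_inj; rewrite /= addeC. Qed.

Fact trop_mul1 : left_id trop_one trop_mul.
Proof. by move=> a; apply: val_inj; rewrite /= add0e. Qed.

Fact trop_mulDl : left_distributive trop_mul trop_add.
Proof. by move=> a b c; apply: val_inj; rewrite /= adde_maxl. Qed.

Fact trop_mul0 : left_zero trop_zero trop_mul.
Proof. by move=> a; apply: val_inj. Qed.

Fact trop_one_neq0 : trop_one != trop_zero.
Proof. by []. Qed.

End Tropical.

HB.instance Definition _ (R : realType) := GRing.isNmodule.Build (trop R)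
  (@trop_addA R) (@trop_addC R) (@trop_add0 R).
HB.instance Definition _ (R : realType) :=
  GRing.Nmodule_isComNzSemiRing.Build (trop R)
    (@trop_mulA R) (@trop_mulC R) (@trop_mul1 R) (@trop_mulDl R)
    (@trop_mul0 R) (@trop_one_neq0 R).

(* The free semimodule of rank 2, with [e_1 = (1, 0)] and [e_2 = (0, 1)]. *)
Notation trop2 R := ((trop R)^o * (trop R)^o)%type.

Section TropicalTheory.
Context {R : realType}.
Implicit Types l m : trop R.

Lemma trop_addE l m :
  trop_val (l + m) = Order.max (trop_val l) (trop_val m).
Proof. by []. Qed.

Lemma trop_mulE l m : trop_val (l * m) = (trop_val l + trop_val m)%E.
Proof. by []. Qed.

Lemma trop2_scale1E l (x : trop2 R) :
  trop_val (l *: x).1 = (trop_val l + trop_val x.1)%E.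
Proof. by []. Qed.

Lemma trop2_scale2E l (x : trop2 R) :
  trop_val (l *: x).2 = (trop_val l + trop_val x.2)%E.
Proof. by []. Qed.

Lemma trop2_add1E (x y : trop2 R) :
  trop_val (x + y).1 = Order.max (trop_val x.1) (trop_val y.1).
Proof. by []. Qed.

Lemma trop2_add2E (x y : trop2 R) :
  trop_val (x + y).2 = Order.max (trop_val x.2) (trop_val y.2).
Proof. by []. Qed.

Lemma trop2_eq1E (x y : trop2 R) :
  (x.1 == y.1) = (trop_val x.1 == trop_val y.1).
Proof. by []. Qed.

Lemma trop2_eq2E (x y : trop2 R) :
  (x.2 == y.2) = (trop_val x.2 == trop_val y.2).
Proof. by []. Qed.

Lemma trop_eq0 l : (l == 0) = (trop_val l == -oo%E).
Proof. by rewrite -val_eqE. Qed.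

Lemma trop_fin l : l != 0 -> trop_val l \is a fin_num.
Proof. by rewrite trop_eq0; case: l => -[]. Qed.

Lemma trop_inv l : l != 0 -> exists2 m, m != 0 & m * l = 1.
Proof.
rewrite trop_eq0; case: l => -[r| |] //= i _.
have j : (- r)%:E != +oo%E by [].
exists (Trop j) => //; apply: val_inj => /=.
by rewrite -EFinD addNr.
Qed.

Variable M : lSemiModType (trop R).
Implicit Types u v : M.

Lemma trop_addvv v : v + v = v.
Proof.
rewrite -{1 2}(scale1r v) -scalerDl.
suff -> : 1 + 1 = 1 :> trop R by rewrite scale1r.
by apply: val_inj; rewrite /= maxxx.
Qed.

Lemma trop_addv_eq0 u v : u + v = 0 -> u = 0.
Proof.
by move=> uv0; rewrite -(addr0 u) -uv0 addrA trop_addvv.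
Qed.

Lemma trop_scale_eq0 l v : l *: v = 0 -> v != 0 -> l = 0.
Proof.
move=> lv0 v0; apply: contra_neq_eq v0 => /trop_inv[m _ ml1].
by rewrite -(scale1r v) -ml1 -scalerA lv0 scaler0.
Qed.

End TropicalTheory.

Section Projective.
Context {R : realType}.
Implicit Types M N : lSemiModType (trop R).

Definition nonzero M := {x : M | x != 0}.

Definition proj_equiv M : rel (nonzero M) :=
  fun x y => `[< exists2 l : trop R, l != 0 & val x = l *: val y >].

Fact proj_equiv_refl M : reflexive (@proj_equiv M).
Proof. by move=> x; apply/asboolP; exists 1; rewrite ?scale1r. Qed.

Fact proj_equiv_sym_imp M (x y : nonzero M) :
  proj_equiv x y -> proj_equiv y x.
Proof.
move=> /asboolP[l /trop_inv[m m0 ml1] xy]; apply/asboolP; exists m => //.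
by rewrite xy scalerA ml1 scale1r.
Qed.

Fact proj_equiv_sym M : symmetric (@proj_equiv M).
Proof. by move=> x y; apply/idP/idP; apply: proj_equiv_sym_imp. Qed.

Fact proj_equiv_trans M : transitive (@proj_equiv M).
Proof.
move=> y x z /asboolP[l l0 xy] /asboolP[m m0 yz]; apply/asboolP.
exists (l * m); last by rewrite xy yz scalerA.
move: l0 m0; rewrite !trop_eq0 trop_mulE.
by case: l {xy} => -[?| |] //=; case: m {yz} => -[?| |].
Qed.

Canonical proj_equiv_rel M := EquivRel (@proj_equiv M)
  (@proj_equiv_refl M) (@proj_equiv_sym M) (@proj_equiv_trans M).

Definition projective M : Type := {eq_quot (@proj_equiv M)}.

HB.instance Definition _ M := Choice.on (projective M).
HB.instance Definition _ M := EqQuotient.on (projective M).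

Definition proj_class M (x : M) (x0 : x != 0) : projective M :=
  \pi_(projective M) (exist _ x x0 : nonzero M).

Definition proj_lift M (a : projective M) : M := val (repr a).

Lemma proj_lift_neq0 M (a : projective M) : proj_lift a != 0.
Proof. exact: valP (repr a). Qed.

Definition kernel_free M N (f : {linear M -> N}) :=
  forall x, x != 0 -> f x != 0.

Definition proj_map M N (f : {linear M -> N}) (f0 : kernel_free f)
  (a : projective M) : projective N := proj_class (f0 _ (proj_lift_neq0 a)).

Lemma proj_eqP M (x y : M) (x0 : x != 0) (y0 : y != 0) :
  proj_class x0 = proj_class y0 <-> exists2 l : trop R, l != 0 & x = l *: y.
Proof.
split=> [/eqquotP/asboolP//|xy]; apply/eqquotP; exact/asboolP.
Qed.

Lemma proj_liftK M (a : projective M) : proj_class (proj_lift_neq0 a) = a.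
Proof.
rewrite /proj_class /proj_lift -[RHS](reprK a); congr (\pi_(projective M) _).
exact: val_inj.
Qed.

Lemma proj_mapE M N (f : {linear M -> N}) (f0 : kernel_free f) (x : M)
  (x0 : x != 0) : proj_map f0 (proj_class x0) = proj_class (f0 _ x0).
Proof.
apply/proj_eqP; have /proj_eqP[l l0 ->] := proj_liftK (proj_class x0).
by exists l => //; rewrite linearZ.
Qed.

Definition tp1_coord (p : projective (trop2 R)) : \bar R :=
  (trop_val (proj_lift p).1 - trop_val (proj_lift p).2)%E.

Lemma tp1_coordE (x : trop2 R) (x0 : x != 0) :
  tp1_coord (proj_class x0) = (trop_val x.1 - trop_val x.2)%E.
Proof.
rewrite /tp1_coord; have /proj_eqP[l l0 ->] := proj_liftK (proj_class x0).
rewrite trop2_scale1E trop2_scale2E; move: (trop_fin l0).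
case: (trop_val l) => // r _.
case: x x0 => [[[s| |] //= ?] [[t| |] //= ?]] x0.
by rewrite -!EFinD opprD addrACA subrr add0r.
Qed.

End Projective.

Section Separated.
Context {R : realType}.
Implicit Types x y z : trop2 R.

Definition sep_equiv : rel (trop2 R) := fun x y =>
  [&& (trop_val x.1 < trop_val x.2)%O, (trop_val y.1 < trop_val y.2)%O
    & x.2 == y.2]
  || [&& (trop_val x.1 >= trop_val x.2)%O, (trop_val y.1 >= trop_val y.2)%O
    & x.1 == y.1].

Fact sep_equiv_refl : reflexive sep_equiv.
Proof. by move=> x; rewrite /sep_equiv !eqxx !andbT !andbb; case: ltP. Qed.

Fact sep_equiv_sym : symmetric sep_equiv.
Proof.
move=> x y; rewrite /sep_equiv (eq_sym x.1) (eq_sym x.2).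
by congr orb; rewrite andbCA.
Qed.

Fact sep_equiv_trans : transitive sep_equiv.
Proof.
move=> y x z; rewrite /sep_equiv.
by case: (ltP (trop_val x.1)) => _; case: (ltP (trop_val y.1)) => _;
  case: (ltP (trop_val z.1)) => _ //=; rewrite ?orbF // => /eqP-> /eqP->.
Qed.

Canonical sep_equiv_rel := EquivRel sep_equiv
  sep_equiv_refl sep_equiv_sym sep_equiv_trans.

Definition sepB : Type := {eq_quot sep_equiv}.

HB.instance Definition _ := Choice.on sepB.
HB.instance Definition _ := EqQuotient.on sepB.

Fact sep_equiv_scale (l : trop R) x y :
  sep_equiv x y -> sep_equiv (l *: x) (l *: y).
Proof.
have [->|l0] := eqVneq l 0.
  by rewrite !scale0r => _; apply: sep_equiv_refl.
have lf := trop_fin l0.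
rewrite /sep_equiv !trop2_eq1E !trop2_eq2E !trop2_scale1E !trop2_scale2E.
rewrite !lteD2lE// !leeD2lE//.
by case/orP=> /and3P[-> -> /eqP->]; rewrite eqxx ?orbT.
Qed.

Fact sep_equiv_add x y z : sep_equiv x y -> sep_equiv (x + z) (y + z).
Proof.
rewrite /sep_equiv !trop2_eq1E !trop2_eq2E !trop2_add1E !trop2_add2E.
case: x y z => [x1 x2] [y1 y2] [z1 z2] /=.
move: (trop_val x1) (trop_val x2) (trop_val y1) (trop_val y2)
  (trop_val z1) (trop_val z2) => {}x1 {}x2 {}y1 {}y2 {}z1 {}z2.
case/orP=> /and3P[]; [move=> + + /eqP xy|move=> + + /eqP xy]; move: xy => <-.
- move=> x12 yx2; case: (leP x2 z1) => [xz|zx].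
    have x1z : (x1 <= z1)%O by apply: (le_trans (ltW x12)).
    have y1z : (y1 <= z1)%O by apply: (le_trans (ltW yx2)).
    by rewrite !(max_r x1z) !(max_r y1z) !eqxx !andbT !andbb ltNge orNb.
  by rewrite !gt_max !lt_max x12 yx2 zx !eqxx.
- move=> x12 yx2; case: (leP z2 x1) => [zx|xz].
    by apply/orP; right; rewrite !ge_max !le_max x12 yx2 zx !eqxx.
  have x2z : (x2 <= z2)%O by apply: (le_trans x12); apply: ltW.
  have y2z : (y2 <= z2)%O by apply: (le_trans yx2); apply: ltW.
  by rewrite !(max_r x2z) !(max_r y2z) !eqxx !andbT !andbb ltNge orNb.
Qed.

Definition sepB_zero : sepB := \pi_sepB 0.
Definition sepB_add (u v : sepB) : sepB := \pi_sepB (repr u + repr v).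
Definition sepB_scale (l : trop R) (u : sepB) : sepB := \pi_sepB (l *: repr u).

Lemma sep_equiv_repr x : sep_equiv (repr (\pi_sepB x)) x.
Proof. by apply/eqquotP; exact: (reprK (\pi_sepB x)). Qed.

Lemma sepB_addE x y : sepB_add (\pi_sepB x) (\pi_sepB y) = \pi_sepB (x + y).
Proof.
apply/eqquotP; apply: (@sep_equiv_trans (x + repr (\pi_sepB y))).
  by apply: sep_equiv_add; apply: sep_equiv_repr.
by rewrite ![x + _]addrC; apply: sep_equiv_add; apply: sep_equiv_repr.
Qed.

Lemma sepB_scaleE l x : sepB_scale l (\pi_sepB x) = \pi_sepB (l *: x).
Proof. by apply/eqquotP; apply: sep_equiv_scale; apply: sep_equiv_repr. Qed.

Fact sepB_addA : associative sepB_add.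
Proof.
move=> u v w; rewrite -(reprK u) -(reprK v) -(reprK w).
by rewrite (sepB_addE (repr v)) (sepB_addE (repr u) (repr v)) !sepB_addE addrA.
Qed.

Fact sepB_addC : commutative sepB_add.
Proof. by move=> u v; rewrite /sepB_add addrC. Qed.

Fact sepB_add0 : left_id sepB_zero sepB_add.
Proof. by move=> u; rewrite -(reprK u) sepB_addE add0r. Qed.

HB.instance Definition _ :=
  GRing.isNmodule.Build sepB sepB_addA sepB_addC sepB_add0.

Fact sepB_scaleA l m u : sepB_scale l (sepB_scale m u) = sepB_scale (l * m) u.
Proof. by rewrite -(reprK u) (sepB_scaleE m) !sepB_scaleE scalerA. Qed.

Fact sepB_scale0 u : sepB_scale 0 u = 0.
Proof. by rewrite -(reprK u) !sepB_scaleE scale0r. Qed.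

Fact sepB_scale1 : left_id 1 sepB_scale.
Proof. by move=> u; rewrite -(reprK u) !sepB_scaleE scale1r. Qed.

Fact sepB_scaleDr : right_distributive sepB_scale +%R.
Proof.
move=> l u v; rewrite -(reprK u) -(reprK v) [X in sepB_scale _ X]sepB_addE.
by rewrite !sepB_scaleE [RHS]sepB_addE scalerDr.
Qed.

Fact sepB_scaleDl u : {morph sepB_scale^~ u : l m / l + m}.
Proof.
move=> l m /=; rewrite -(reprK u) !sepB_scaleE [RHS]sepB_addE.
by rewrite scalerDl.
Qed.

HB.instance Definition _ := GRing.Nmodule_isLSemiModule.Build (trop R) sepB
  sepB_scaleA sepB_scale0 sepB_scale1 sepB_scaleDr sepB_scaleDl.

End Separated.
Arguments sepB : clear implicits.

Definition separated_semimod (R : realType) (M : lSemiModType (trop R)) :=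
  ~ exists N : {pred M}, GRing.subsemimod_closed N /\
      exists g : {linear sepB R -> M}, set_bij [set: sepB R] [set` N] g.

Section CanonicalMetric.
Context {R : realType} {M : lSemiModType (trop R)}.

Definition span2 (u v : M) (x : trop2 R) : M :=
  (x.1 : trop R) *: u + (x.2 : trop R) *: v.

Fact span2_semilinear u v : semilinear (span2 u v).
Proof.
split=> [l x|x y]; rewrite /span2 /=.
  by rewrite scalerDr !scalerA.
by rewrite !scalerDl addrACA.
Qed.

HB.instance Definition _ u v :=
  GRing.isSemilinear.Build (trop R) (trop2 R) M _ (span2 u v)
    (span2_semilinear u v).

Lemma span2_kernel_free (u v : M) :
  u != 0 -> v != 0 -> kernel_free (span2 u v).
Proof.
move=> u0 v0 x; apply: contra_neq => uv0.
have x1 : (x.1 : trop R) = 0 by apply: (trop_scale_eq0 (trop_addv_eq0 uv0)).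
move: uv0; rewrite /= /span2 addrC => /trop_addv_eq0/trop_scale_eq0/(_ v0) x2.
by case: x x1 x2 => /= ? ? -> ->.
Qed.

(* The projective map sending [0_T = [0 : 1]] to [a] and
   [oo_T = [1 : 0]] to [b]. *)
Definition proj_segment (a b : projective M) :
    projective (trop2 R) -> projective M :=
  proj_map (span2_kernel_free (proj_lift_neq0 b) (proj_lift_neq0 a)).

(* The conventions on [\bar R] give [`|+oo - +oo| = `|-oo - -oo| = +oo], so
   [cdist a b] is finite if and only if both extremal points are. *)
Definition cdist (a b : projective M) : \bar R :=
  if a == b then 0%E else
  let f := proj_segment a b in
  let a0 := ereal_sup (tp1_coord @` (f @^-1` [set a])) in
  let b0 := ereal_inf (tp1_coord @` (f @^-1` [set b])) in
  `|a0 - b0|%E.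

(* The metric topology is given by its open sets, which requires no proof that
   [cdist] is a metric; [cdist] is one under the hypotheses that [M] is
   separated and that [cdist] is finite. *)
Definition cdist_open (U : set (projective M)) : Prop :=
  forall a, U a ->
    exists2 e : R, 0 < e & forall b, (cdist a b < e%:E)%E -> U b.

Fact cdist_openT : cdist_open setT.
Proof. by move=> a _; exists 1. Qed.

Fact cdist_openI : setI_closed cdist_open.
Proof.
move=> U V Uo Vo a [Ua Va].
have [e e0 He] := Uo a Ua; have [e' e'0 He'] := Vo a Va.
exists (Num.min e e'); first by rewrite lt_min e0.
by move=> b ab; split; [apply: He|apply: He']; apply: (lt_le_trans ab);
  rewrite lee_fin ge_min lexx ?orbT.
Qed.

Fact cdist_open_bigU (I : Type) (F : I -> set (projective M)) :
  (forall i, cdist_open (F i)) -> cdist_open (\bigcup_i F i).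
Proof.
move=> Fo a [i _ Fia]; have [e e0 He] := Fo i a Fia.
by exists e => // b /He Fib; exists i.
Qed.

HB.instance Definition _ := isOpenTopological.Build (projective M)
  cdist_openT cdist_openI cdist_open_bigU.

End CanonicalMetric.

Definition homotopic (R : realType) (X Y : topologicalType) (f g : X -> Y) :=
  exists H : X * R -> Y,
    [/\ {within [set: X] `*` `[0, 1], continuous H},
        forall x, H (x, 0) = f x & forall x, H (x, 1) = g x].

(* The base point makes the empty space non-contractible. *)
Definition contractible (R : realType) (X : topologicalType) :=
  exists p : X, homotopic R (@id X) (cst p).

(* Main.v *)
(* In the order u <= v iff u (+) v = v, finiteness of the metric makes d the
   (pseudo-)Hilbert metric: d(u, v) < e iff s u <= v and s' v <= u for some
   reals s, s' with s + s' > - e.  Fix a base point w and normalise the lift u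
   of each point so that sup {s | s u <= w} = 0.  With this normalisation, u
   and v with d(u, v) < e satisfy (- e) u <= v and (- e) v <= u, so
   u (+) c w depends continuously on the class of u and on the scalar c: c = 0_T
   gives the class of u, and c = 1 gives the class of w. *)

Require Import Defs.
From mathcomp Require Import all_boot all_order all_algebra.
From mathcomp Require Import all_classical all_reals all_analysis.
From mathcomp Require Import lra.
Local Open Scope ring_scope.

Set Implicit Arguments.
Unset Strict Implicit.
Unset Printing Implicit Defensive.

Import Order.TTheory GRing.Theory Num.Theory.
Import numFieldNormedType.Exports.
Local Open Scope classical_set_scope.

(** * Real scalars and the canonical order of a tropical semimodule *)

Section Semimodule.
Context {R : realType} {M : lSemiModType (trop R)}.
Implicit Types (u v w : M) (r s t : R).

Fact trop_of_subproof r : r%:E != +oo%E.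
Proof. by []. Qed.

Definition trop_of r : trop R := Trop (trop_of_subproof r).

Lemma trop_ofP (l : trop R) : l != 0 -> exists r, l = trop_of r.
Proof.
rewrite trop_eq0; case: l => -[r| |] //= i _.
by exists r; apply: val_inj.
Qed.

Lemma trop_of_neq0 r : trop_of r != 0.
Proof. by rewrite trop_eq0. Qed.

Lemma trop_ofD r s : trop_of (r + s) = trop_of r * trop_of s.
Proof. by apply: val_inj; rewrite /= EFinD. Qed.

Lemma trop_of0 : trop_of 0 = 1.
Proof. exact: val_inj. Qed.

Lemma trop_of_max r s : r <= s -> trop_of r + trop_of s = trop_of s.
Proof. by move=> rs; apply: val_inj => /=; apply: max_r; rewrite lee_fin. Qed.

Definition shift r u : M := trop_of r *: u.

Lemma shiftA r s u : shift r (shift s u) = shift (r + s) u.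
Proof. by rewrite /shift scalerA -trop_ofD. Qed.

Lemma shift0 u : shift 0 u = u.
Proof. by rewrite /shift trop_of0 scale1r. Qed.

Lemma shiftD r u v : shift r (u + v) = shift r u + shift r v.
Proof. exact: scalerDr. Qed.

Lemma shift_neq0 r u : u != 0 -> shift r u != 0.
Proof.
by move=> u0; apply: contraNneq (trop_of_neq0 r) => /trop_scale_eq0/(_ u0) ->.
Qed.

Definition tle u v := u + v = v.

Lemma tle_refl u : tle u u.
Proof. exact: trop_addvv. Qed.

Lemma tle_trans v u w : tle u v -> tle v w -> tle u w.
Proof. by rewrite /tle => uv vw; rewrite -vw addrA uv. Qed.

Lemma tle_anti u v : tle u v -> tle v u -> u = v.
Proof. by rewrite /tle addrC => -> ->. Qed.

Lemma tle_addl u v : tle u (u + v).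
Proof. by rewrite /tle addrA trop_addvv. Qed.

Lemma tle_add u v u' v' : tle u u' -> tle v v' -> tle (u + v) (u' + v').
Proof. by rewrite /tle => uu vv; rewrite addrACA uu vv. Qed.

Lemma tle_shift r u v : tle u v -> tle (shift r u) (shift r v).
Proof. by rewrite /tle -shiftD => ->. Qed.

Lemma tle_shift_mono r s u : r <= s -> tle (shift r u) (shift s u).
Proof. by move=> rs; rewrite /tle /shift -scalerDl trop_of_max. Qed.

Lemma tle_shiftE r u v : tle u (shift r v) <-> tle (shift (- r) u) v.
Proof.
split=> /tle_shift h.
  by have := h (- r); rewrite shiftA addNr shift0.
by have := h r; rewrite shiftA addrN shift0.
Qed.

Lemma tle_comp r s u v w :
  tle (shift r u) v -> tle (shift s v) w -> tle (shift (s + r) u) w.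
Proof. by move=> /(@tle_shift s) + vw; rewrite shiftA => /tle_trans; apply. Qed.

Lemma neq0_tle u v : tle u v -> u != 0 -> v != 0.
Proof. by move=> uv; apply: contraNneq => v0; rewrite -(addr0 u) -v0 uv v0. Qed.

(** The witnesses [s] and [s'] stand in for two suprema, which need not be attained. *)
Definition hilbert_lt e u v :=
  exists s s', [/\ tle (shift s u) v, tle (shift s' v) u & - e < s + s'].

Lemma hilbert_lt_sym e u v : hilbert_lt e u v -> hilbert_lt e v u.
Proof. by case=> s [s' [a b c]]; exists s', s; rewrite addrC. Qed.

Lemma hilbert_lt_shift e r u v : hilbert_lt e u v -> hilbert_lt e u (shift r v).
Proof.
move=> [s [s' [uv vu ss]]]; exists (r + s), (s' - r); split.
- by rewrite -shiftA; exact: tle_shift.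
- by rewrite shiftA subrK.
- lra.
Qed.

Lemma hilbert_lt_refl e r u : 0 < e -> hilbert_lt e u (shift r u).
Proof.
move=> e0; apply: hilbert_lt_shift; exists 0, 0.
by rewrite shift0; split; [exact: tle_refl|exact: tle_refl|lra].
Qed.

(* Multiplying [t v + u = l u] by [l > 0] and substituting [t v + u] for
   [l u] pushes the coefficient of [v] arbitrarily high. *)
Lemma absorb_iter t l u v n : 0 < l -> shift t v + u = shift l u ->
  shift (t + n%:R * l) v + u = shift (n%:R * l + l) u.
Proof.
move=> l0 tl; elim: n => [|n IH]; first by rewrite mul0r addr0 add0r.
have := congr1 (shift l) IH; rewrite shiftD !shiftA -tl addrA.
have -> : l + (t + n%:R * l) = t + n.+1%:R * l by rewrite -natr1; lra.
have -> : l + (n%:R * l + l) = n.+1%:R * l + l by rewrite -natr1; lra.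
rewrite [shift _ v + shift _ v]addrC.
have -> // : shift t v + shift (t + n.+1%:R * l) v = shift (t + n.+1%:R * l) v.
by apply: tle_shift_mono; rewrite lerDl mulr_ge0 // ltW.
Qed.

(** The fibres in [cdist] give equations [t v + u = l u], not inequalities. If [l > 0],
    [absorb_iter] pushes the coefficient of [v] past the bound [A]; hence [l <= 0] and
    [t v <= l u <= u]. *)
Lemma absorb_tle A u v : (forall t l, shift t v + u = shift l u -> t <= A) ->
  forall t l, shift t v + u = shift l u -> tle (shift t v) u.
Proof.
move=> bnd t l tl; case: (leP l 0) => [l0|l0].
  apply: (@tle_trans (shift l u)); first by rewrite -tl; exact: tle_addl.
  by rewrite -{2}(shift0 u); exact: tle_shift_mono.
have /archi_boundP := normr_ge0 ((A - t) / l).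
set n := Num.bound _ => hn.
have := bnd _ _ (absorb_iter n l0 tl).
have : (A - t) / l < n%:R by apply: le_lt_trans hn; exact: ler_norm.
rewrite ltr_pdivrMr //; clear tl; lra.
Qed.

Lemma tle_absorb t u v : tle (shift t v) u -> shift t v + u = shift 0 u.
Proof. by rewrite shift0. Qed.

End Semimodule.

(** * The canonical metric expressed through the order *)

Section CanonicalMetricTheory.
Context {R : realType} {M : lSemiModType (trop R)}.
Implicit Types (a b c : projective M) (r s t : R).

Lemma proj_lift_class (x : M) (x0 : x != 0) :
  exists r, proj_lift (proj_class x0) = shift r x.
Proof.
have /proj_eqP[l /trop_ofP[r ->] ->] := proj_liftK (proj_class x0).
by exists r.
Qed.

Lemma proj_class_eq a (x : M) (x0 : x != 0) :
  proj_class x0 = a <-> exists r, x = shift r (proj_lift a).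
Proof.
rewrite -[X in _ = X]proj_liftK; split.
  by move=> /proj_eqP[l /trop_ofP[r ->] ->]; exists r.
by move=> [r xr]; apply/proj_eqP; exists (trop_of r); first exact: trop_of_neq0.
Qed.

Lemma segment_coordP a b c r :
  (tp1_coord @` (proj_segment a b @^-1` [set c])) r%:E <->
  exists l, shift r (proj_lift b) + proj_lift a = shift l (proj_lift c).
Proof.
split=> [[p /= pc pr]|[l rl]].
  move: pc pr; rewrite /proj_segment /proj_map /tp1_coord => /proj_class_eq[l].
  case: (proj_lift p) => [[x1 i1] [x2 i2]]; rewrite /= /span2 /=.
  case: x1 i1 => [x1| |] // i1; case: x2 i2 => [x2| |] // i2.
  have -> : Trop i1 = trop_of x1 by exact: val_inj.
  have -> : Trop i2 = trop_of x2 by exact: val_inj.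
  (* A real coordinate leaves only real [x1] and [x2]; scaling by [- x2] makes the representative
     [(r, 1)]. *)
  move=> /(congr1 (shift (- x2))).
  rewrite -!/(shift _ _) shiftD !shiftA addNr shift0 -EFinB => h [<-].
  by exists (- x2 + l); rewrite -h [- x2 + x1]addrC.
have x0 : ((trop_of r, 1) : trop2 R) != 0 by rewrite xpair_eqE negb_and oner_eq0 orbT.
exists (proj_class x0); last by rewrite tp1_coordE /= oppr0 adde0.
rewrite /= /proj_segment proj_mapE; apply/proj_class_eq; exists l.
by rewrite /= /span2 /= scale1r.
Qed.

Context (cdist_fin : forall a b, (cdist a b < +oo)%E).

(** [A] and [B] are the extremal points of the fibres over [a] and [b]; [absorb_tle] turns the fibre
    equations into inequalities. *)
Lemma cdist_extremal a b : a != b ->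
  let u := proj_lift a in let v := proj_lift b in
  exists A B : R, [/\ cdist a b = `|A - B|%:E,
    forall t, tle (shift t v) u -> t <= A,
    forall e, 0 < e -> exists2 t, tle (shift t v) u & A - e < t,
    forall t, tle u (shift t v) -> B <= t &
    forall e, 0 < e -> exists2 t, tle u (shift t v) & t < B + e].
Proof.
move=> ab u v; have := cdist_fin a b; rewrite /cdist (negbTE ab).
set SA := tp1_coord @` _; set SB := tp1_coord @` _.
have : ubound SA (ereal_sup SA) by exact: ereal_sup_ubound.
have : lbound SB (ereal_inf SB) by exact: ereal_inf_lbound.
have : forall e, 0 < e -> ereal_inf SB \is a fin_num ->
    exists2 x, SB x & (x < ereal_inf SB + e%:E)%E.
  by move=> e e0 /lb_ereal_inf_adherent; apply.
have : forall e, 0 < e -> ereal_sup SA \is a fin_num ->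
    exists2 x, SA x & (ereal_sup SA - e%:E < x)%E.
  by move=> e e0 /ub_ereal_sup_adherent; apply.
(* An infinite extremal point would make the distance infinite. *)
case: (ereal_sup SA) => [A| |]; case: (ereal_inf SB) => [B| |] //=.
move=> supA infB lbB ubA _.
have ubA' t l : shift t v + u = shift l u -> t <= A.
  by move=> h; rewrite -lee_fin; apply: ubA; apply/segment_coordP; exists l.
(* Negating the coordinate gives the fibre over [b] the shape required by [absorb_tle], with [u] and
   [v] exchanged. *)
have lbB' t l : shift t u + v = shift l v -> t <= - B.
  move=> h; rewrite lerNr -lee_fin; apply: lbB; apply/segment_coordP.
  exists (- t + l); rewrite -/u -/v -[RHS]shiftA -h shiftD shiftA addNr shift0.
  by rewrite addrC.
have fin r : r%:E \is a fin_num by [].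
exists A, B; split=> //.
- by move=> t /tle_absorb; exact: ubA'.
- move=> e /supA /(_ (fin _)) [x SAx].
  have := ubA _ SAx; case: x SAx => [x| |] // /segment_coordP [l xl] _.
  by rewrite -EFinB lte_fin => ex; exists x => //; exact: absorb_tle ubA' _ _ xl.
- by move=> t /tle_shiftE /tle_absorb /lbB'; rewrite lerN2.
- move=> e /infB /(_ (fin _)) [x SBx].
  have := lbB _ SBx; case: x SBx => [x| |] // /segment_coordP [l xl] _.
  rewrite -EFinD lte_fin => ex; exists x => //; apply/tle_shiftE.
  apply: absorb_tle lbB' _ (- x + l) _.
  by rewrite -shiftA -xl shiftD shiftA addNr shift0 addrC.
Qed.

Lemma cdist_ltP a b e : 0 < e ->
  (cdist a b < e%:E)%E <-> hilbert_lt e (proj_lift a) (proj_lift b).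
Proof.
move=> e0; have [<-|ab] := eqVneq a b.
  rewrite /cdist eqxx lte_fin; split=> // _.
  by rewrite -[X in hilbert_lt _ _ X]shift0; exact: hilbert_lt_refl.
have [A [B [-> leA supA leB infB]]] := cdist_extremal ab.
rewrite lte_fin; split=> [AB|[s [s' [sv /leA s'A ss]]]].
  (* The slack is shared between the approximations of [A] and of [B]. *)
  have d0 : 0 < (e - `|A - B|) / 2 by lra.
  have [t tA At] := supA _ d0; have [t' tB Bt] := infB _ d0.
  exists (- t'), t; split=> //; first exact/tle_shiftE.
  by have := ler_norm (B - A); rewrite distrC; lra.
have Bs : B <= - s by apply: leB; apply/tle_shiftE; rewrite opprK.
(* Otherwise [t v <= u <= t' v] for some [t' <= t], which forces [u = t' v] and [a = b]. *)
have AB : A <= B.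
  rewrite leNgt; apply: contra_neqN ab => BA.
  have d0 : 0 < (A - B) / 2 by lra.
  have [t tA At] := supA _ d0; have [t' tB Bt] := infB _ d0.
  have tt : t' <= t by lra.
  rewrite -(proj_liftK a); apply/proj_class_eq; exists t'.
  by apply: tle_anti tB _; apply: tle_trans tA; exact: tle_shift_mono.
by rewrite ltr_norml; apply/andP; split; clear sv; lra.
Qed.

Lemma cdist_class_lt e (x y : M) (x0 : x != 0) (y0 : y != 0) : 0 < e ->
  hilbert_lt e x y -> (cdist (proj_class x0) (proj_class y0) < e%:E)%E.
Proof.
move=> e0 xy; apply/cdist_ltP => //.
have [r ->] := proj_lift_class x0; have [s ->] := proj_lift_class y0.
apply: hilbert_lt_shift; apply: hilbert_lt_sym; apply: hilbert_lt_shift.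
exact: hilbert_lt_sym.
Qed.

(** The topology is given by its open sets, so balls must be shown to be open; this is the triangle
    inequality, supplied by [tle_comp]. *)
Lemma cdist_nbhsP a (U : set (projective M)) :
  nbhs a U <->
  exists2 e, 0 < e & forall b, hilbert_lt e (proj_lift a) (proj_lift b) -> U b.
Proof.
rewrite nbhsE; split=> [[V [Vo Va] VU]|[e e0 aU]].
  have [e e0 He] := Vo a Va; exists e => // b /(cdist_ltP _ _ e0) /He.
  exact: VU.
exists [set b | (cdist a b < e%:E)%E]; last by move=> b /= /(cdist_ltP _ _ e0)/aU.
split; last by rewrite /= /cdist eqxx lte_fin.
move=> b /= /(cdist_ltP _ _ e0)[s [s' [ab ba ss]]].
(* The slack in the strict inequality at [b] is the radius of a ball around [b] inside the given
   one. *)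
have d0 : 0 < s + s' + e by lra.
exists (s + s' + e) => // c /(cdist_ltP _ _ d0) bc; apply/cdist_ltP => //.
have [t [t' [bc' cb tt]]] := bc.
exists (t + s), (s' + t'); split; [exact: tle_comp bc'|exact: tle_comp ba|lra].
Qed.

(** * Normalised lifts *)

Lemma tle_shift_ex a b : exists r, tle (shift r (proj_lift b)) (proj_lift a).
Proof.
have [<-|ab] := eqVneq a b; first by exists 0; rewrite shift0; exact: tle_refl.
have [A [B [_ _ supA _ _]]] := cdist_extremal ab.
by have [r] := supA 1 ltr01; exists r.
Qed.

(** When [a = b], the bound is transferred from a point [e] other than [a]: [s e <= a] and
    [r a <= a] give [(r + s) e <= a]. With a single point it can fail, as in [{0, x}] where every
    real fixes [x]. *)
Lemma tle_shift_bounded a b : (exists c d : projective M, c != d) ->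
  exists A, forall r, tle (shift r (proj_lift b)) (proj_lift a) -> r <= A.
Proof.
move=> [c [d cd]].
have ub (e f : projective M) : e != f ->
    exists A, forall r, tle (shift r (proj_lift f)) (proj_lift e) -> r <= A.
  by move=> ef; have [A [B [_ leA _ _ _]]] := cdist_extremal ef; exists A.
have [<-|] := eqVneq a b; last exact: ub.
have [e ae] : exists e : projective M, a != e.
  have [ac|] := eqVneq a c; last by exists c.
  by exists d; rewrite ac.
have [A leA] := ub a e ae; have [s sea] := tle_shift_ex a e.
exists (A - s) => r raa; rewrite lerBrDr; apply: leA.
exact: tle_comp sea raa.
Qed.

(** The lift is rescaled by a supremum that need not be attained, hence the strict [s < 0]. *)
Lemma normalized_lift a b : (exists c d : projective M, c != d) ->
  exists u : M, [/\ exists r, u = shift r (proj_lift a),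
    forall s, s < 0 -> tle (shift s u) (proj_lift b) &
    forall s, tle (shift s u) (proj_lift b) -> s <= 0].
Proof.
move=> /(tle_shift_bounded b a)[A leA].
set S := [set r | tle (shift r (proj_lift a)) (proj_lift b)].
have supS : has_sup S.
  by split; [have [r] := tle_shift_ex b a; exists r|exists A].
exists (shift (sup S) (proj_lift a)); split; first by exists (sup S).
- move=> s s0; have [r Sr sr] : exists2 r, S r & sup S - - s < r.
    by apply: sup_adherent supS; lra.
  rewrite shiftA; apply: tle_trans Sr; apply: tle_shift_mono; lra.
- move=> s; rewrite shiftA => Ss.
  by have := ub_le_sup supS.2 Ss; lra.
Qed.

(** Normalisation forces [s <= 0], so the bound on [s + s'] becomes the one-sided bound
    [- e < s']. *)
Lemma normalized_tle e (w u v : M) :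
  (forall s, s < 0 -> tle (shift s v) w) ->
  (forall s, tle (shift s u) w -> s <= 0) ->
  hilbert_lt e u v -> tle (shift (- e) v) u.
Proof.
move=> vw uw [s [s' [uv vu ss]]].
have s0 : s <= 0.
  (* As [v <= w] may fail, half of [s] is given up: [(- s / 2) v <= w] still yields
     [(s / 2) u <= w]. *)
  rewrite leNgt; apply/negP => s0; have : - s / 2 < 0 by lra.
  by move=> /vw /(tle_comp uv) /uw; lra.
apply: tle_trans vu; apply: tle_shift_mono; lra.
Qed.

(* Bounded above by r on a neighbourhood of 0 for every real r, and equal to the
   real number 1, not the unit of [trop R], at 1: the normalised lift u satisfies
   u <= s w for s > 0 but perhaps not u <= w. *)
Definition contraction_coef (t : R) : trop R :=
  if t <= 0 then 0 else trop_of (2 - t^-1).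

(** * The homotopy obtained by adding multiples of the base vector *)

Section Contraction.
Context (p : projective M) (u : projective M -> M).
Context (u_lift : forall a, exists r, u a = shift r (proj_lift a)).
Context (u_tle : forall a s, s < 0 -> tle (shift s (u a)) (proj_lift p)).
Context (u_tight : forall a s, tle (shift s (u a)) (proj_lift p) -> s <= 0).

Let w := proj_lift p.

Lemma contraction_neq0 (z : projective M * R) :
  u z.1 + contraction_coef z.2 *: w != 0.
Proof.
apply: neq0_tle (tle_addl _ _) _; have [r ->] := u_lift z.1.
by apply: shift_neq0; exact: proj_lift_neq0.
Qed.

Definition contraction (z : projective M * R) : projective M :=
  proj_class (contraction_neq0 z).

Lemma contraction0 a : contraction (a, 0) = a.
Proof.
apply/proj_class_eq; have [r ur] := u_lift a; exists r.
by rewrite /contraction_coef /= lexx scale0r addr0.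
Qed.

Lemma contraction1 a : contraction (a, 1) = p.
Proof.
apply/proj_class_eq; exists 1; rewrite /contraction_coef /= ler10 invr1.
have -> : (2 - 1 : R) = 1 by lra.
(* The goal [u a + 1 w = 1 w], with 1 the real number, unfolds to [u a <= 1 w]. *)
by apply/tle_shiftE; apply: u_tle; rewrite ltrN10.
Qed.

Lemma hilbert_lt_normalized e a b :
  hilbert_lt e (proj_lift a) (proj_lift b) -> hilbert_lt e (u a) (u b).
Proof.
move=> ab; have [r ->] := u_lift a; have [s ->] := u_lift b.
apply: hilbert_lt_shift; apply: hilbert_lt_sym; apply: hilbert_lt_shift.
exact: hilbert_lt_sym.
Qed.

Lemma normalized_lipschitz e a b :
  hilbert_lt e (proj_lift a) (proj_lift b) -> tle (shift (- e) (u a)) (u b).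
Proof.
move=> /hilbert_lt_normalized/hilbert_lt_sym.
by apply: normalized_tle; [exact: u_tle|exact: u_tight].
Qed.

(** For [t <= 0] the multiple of [w] is absorbed by [u b] at all nearby points; for [t > 0] the
    coefficient is real and continuous, and the sums are compared summand by summand. *)
Lemma contraction_continuous : continuous contraction.
Proof.
move=> [a t] U /cdist_nbhsP[e e0 eU].
have {}eU b t' : hilbert_lt e (u a + contraction_coef t *: w)
    (u b + contraction_coef t' *: w) -> U (contraction (b, t')).
  move=> ab; apply: eU; apply/cdist_ltP => //; exact: cdist_class_lt.
have [t0|t0] := leP t 0.
  have [r ra] : exists r, tle (shift r w) (u a).
    have [r ->] := u_lift a; have [s sa] := tle_shift_ex a p.
    by exists (r + s); rewrite -shiftA; exact: tle_shift.
  (* For [0 < t' < k^-1] the coefficient [2 - t'^-1] is below [r - e], and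
     [(r - e) w <= (- e) (u a) <= u b]. *)
  pose k := `|2 - r + e| + 1.
  have k0 : 0 < k by rewrite ltr_wpDl.
  exists ([set b | hilbert_lt e (proj_lift a) (proj_lift b)],
          [set t' | t' < k^-1]) => /=.
    split; first by apply/cdist_nbhsP; exists e.
    by apply: lt_nbhsl; apply: le_lt_trans t0 _; rewrite invr_gt0.
  move=> [b t'] /= [ab tk]; apply: eU.
  rewrite {1}/contraction_coef t0 scale0r addr0.
  suff : tle (contraction_coef t' *: w) (u b).
    by rewrite /tle addrC => ->; exact: hilbert_lt_normalized.
  rewrite /contraction_coef; case: ifPn => [_|]; rewrite ?scale0r.
    exact: add0r.
  rewrite -ltNge => t'0; apply: tle_trans (normalized_lipschitz ab).
  apply: tle_trans (tle_shift (- e) ra); rewrite shiftA; apply: tle_shift_mono.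
  have : k < t'^-1 by rewrite -[k]invrK ltf_pV2 ?posrE ?invr_gt0.
  by have := ler_norm (2 - r + e); rewrite /k; lra.
(* Each of the two comparisons loses [d], and [2 d < e] leaves the inequality strict. *)
pose d := e / 4.
have d0 : 0 < d by rewrite divr_gt0.
exists ([set b | hilbert_lt d (proj_lift a) (proj_lift b)],
        [set t' | 0 < t' /\ `|t^-1 - t'^-1| < d]) => /=.
  split; first by apply/cdist_nbhsP; exists d.
  apply: filterI; first exact: lt_nbhsr.
  have /cvgrPdist_lt : x^-1 @[x --> t] --> t^-1 by apply: inv_continuous; lra.
  exact.
move=> [b t'] /= [ab [t'0]]; rewrite ltr_norml => /andP[tt tt'].
apply: eU; rewrite /contraction_coef !leNgt t0 t'0 /=.
exists (- d), (- d); rewrite -!/(shift _ _) !shiftD !shiftA; split.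
- apply: tle_add; first exact: normalized_lipschitz.
  by apply: tle_shift_mono; lra.
- apply: tle_add; first by apply: normalized_lipschitz; exact: hilbert_lt_sym.
  by apply: tle_shift_mono; lra.
- rewrite /d; lra.
Qed.

End Contraction.

End CanonicalMetricTheory.

Theorem proposition5p9 (R : realType) (M : lSemiModType (trop R))
    (M_neq0 : exists x : M, x != 0)
    (M_sep : separated_semimod M)
    (cdist_fin : forall a b : projective M, (cdist a b < +oo)%E) :
  contractible R (projective M).
Proof.
have [x x0] := M_neq0; pose p := proj_class x0; exists p.
have [ne|/forallNP eqM] := pselect (exists c d : projective M, c != d).
  have [u uP] := choice (fun a => normalized_lift cdist_fin a p ne).
  have u_lift a : exists r, u a = shift r (proj_lift a) by case: (uP a).
  exists (contraction p u_lift); split.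
  - apply: continuous_subspaceT; apply: contraction_continuous => //.
    + by move=> a; case: (uP a).
    + by move=> a; case: (uP a).
  - exact: contraction0.
  - by apply: contraction1 => a; case: (uP a).
(* Normalised lifts may not exist over a one-point space; there the constant homotopy serves. *)
have eqp a : a = p by apply/eqP; apply: contra_notT (eqM a) => ap; exists p.
exists (fun=> p); split=> //.
by apply: continuous_subspaceT => z; exact: cvg_cst.
Qed.
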